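(* There is a separable Banach space $X$ (over $\mathbb{K}$) and a balanced norm-open set $U\subsetneqq B_{X^*}$ in $X^*$ such that $\tilde U=U$ and $U$ is weak* dense in $B_{X^*}$. One can take, for example, $X=\ell_1$ (so that $X^*=\ell_\infty$).
   Context: $\mathbb{K}$ denotes either $\mathbb{R}$ or $\mathbb{C}$. $B_{X^*}$ is the open unit ball of the dual $X^*$. ''Open'' means norm-open; $U$ is balanced if $tU\subset U$ for all $t\in\mathbb{K}$ with $|t|\le 1$. For a norm-open set $U\subset X^*$, a subset $B\subset U$ is called $U$-bounded if it is bounded and has positive distance to $X^*\setminus U$ (the distance condition being void if $U=X^*$). The envelope of $U$ is $\tilde U:=\bigcup\{\overline{B}^{w^*}: B\subset U \text{ is } U\text{-bounded}\}$, where $\overline{B}^{w^*}$ is the weak* closure in $X^*$ (with respect to $w(X^*,X)$). *)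

(* Defs.v *)
From HB Require Import structures.
From mathcomp Require Import all_boot all_order all_algebra.
From mathcomp Require Import complex.
From mathcomp Require Import all_classical all_reals all_analysis.

Set Implicit Arguments.
Unset Strict Implicit.
Unset Printing Implicit Defensive.

Import Order.TTheory GRing.Theory Num.Def Num.Theory.
Import numFieldNormedType.Exports.

Local Open Scope classical_set_scope.
Local Open Scope ring_scope.

Inductive scalar_kind := real_scalars | complex_scalars.

Definition scalar_field (R : realType) (k : scalar_kind) : numFieldType :=
  match k with
  | real_scalars => R
  | complex_scalars => R[i]
  end.

Section ScalarField.
Variables (R : realType) (k : scalar_kind).
Local Notation K := (scalar_field R k).

Lemma scalar_supremums (A : set K) (M : K) :
  A !=set0 -> A `<=` [set x | 0 <= x] -> ubound A M -> supremums A !=set0.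
Proof.
case: k A M => [A M [a Aa] A0 AM|A M [a Aa] A0 AM].
  have sA : has_sup (A : set R) by split; [exists a|exists M].
  exists (sup (A : set R)); split; first exact: sup_upper_bound.
  by move=> b Ab; apply: ge_sup => //; exists a.
have AE z : A z -> z = (complex.Re z)%:C%C.
  by move=> /A0/= z0; rewrite RRe_real// ger0_real.
pose B : set R := [set complex.Re z | z in A].
have MR z : ubound A z -> z = (complex.Re z)%:C%C.
  move=> /(_ _ Aa) az; rewrite RRe_real// ger0_real//.
  by apply: le_trans az; exact: (A0 _ Aa).
have BM z : ubound A z -> ubound B (complex.Re z).
  move=> Az _ [w Aw <-]; have := Az _ Aw.
  by rewrite (AE _ Aw) (MR _ Az) /= lecR.
have sB : has_sup B.
  by split; [exists (complex.Re a), a|exists (complex.Re M); exact: BM].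
exists ((sup B)%:C)%C; split.
  move=> z Az; rewrite (AE _ Az) lecR; apply: sup_upper_bound => //.
  by exists z.
move=> z Az; rewrite (MR _ Az) lecR; apply: ge_sup; last exact: BM.
by exists (complex.Re a), a.
Qed.

Lemma scalar_nondecreasing_cvg (u : nat -> K) (M : K) :
  (forall n, 0 <= u n) -> nondecreasing_seq u -> (forall n, u n <= M) ->
  exists s, [/\ u @ \oo --> s, forall n, u n <= s &
    forall M', (forall n, u n <= M') -> s <= M'].
Proof.
move=> u0 un uM.
have [s [us ls]] : supremums (range u) !=set0.
  apply: (@scalar_supremums _ M); first by exists (u 0%N), 0%N.
    by move=> _ [n _ <-]; exact: u0.
  by move=> _ [n _ <-]; exact: uM.
have us' n : u n <= s by apply: us; exists n.
have s0 : 0 <= s by exact: le_trans (u0 0%N) (us' 0%N).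
exists s; split=> // [|M' uM']; last by apply: ls => _ [n _ <-]; exact: uM'.
apply/cvgrPdist_lt => e e0.
have [n sn] : exists n, s - e < u n.
  apply: contrapT => /forallNP h.
  have : s <= s - e.
    apply: ls => _ [n _ <-].
    have [//|h'] := real_leP (ger0_real (u0 n)) (realB (ger0_real s0) (gtr0_real e0)).
    by have := h n.
  by rewrite lt_geF ?gtrBl.
near=> m.
rewrite ger0_norm ?subr_ge0// ltrBlDl -ltrBlDr (lt_le_trans sn)//.
by apply: un; near: m; exact: nbhs_infty_ge.
Unshelve. all: by end_near. Qed.

Lemma scalar_complete (F : set_system K) :
  ProperFilter F -> cauchy F -> cvg F.
Proof.
case: k F => [|F FF Fc]; first exact: R_complete.
have norm_le (z : R[i]) : `|z| <= (`|complex.Re z| + `|complex.Im z|)%:C%C.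
  rewrite {1}(complexE z) rmorphD/= (le_trans (ler_normD _ _))//.
  rewrite lerD//; first by rewrite normc_def /= expr0n addr0 sqrtr_sqr.
  by rewrite normrM normc_def /= expr0n expr1n add0r sqrtr1 mul1r normc_def /=
       expr0n addr0 sqrtr_sqr.
have part_cvg (p : R[i] -> R) : {morph p : x y / x - y} ->
    (forall z, (`|p z|)%:C%C <= `|z|) -> cvg (p @ F).
  move=> pB pN; apply: R_complete; apply/cauchy_ballP => e e0.
  have /cauchy_ballP/(_ (e%:C%C)) := Fc.
  rewrite ltcR => /(_ e0) [[A B] /= [FA FB] AB].
  exists (p @` A, p @` B) => /=.
    by split; [apply: filterS FA|apply: filterS FB] => x Ax /=; exists x.
  move=> [_ _] /= [[x Ax <-] [y By <-]]; rewrite /ball/= -pB -ltcR.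
  exact: le_lt_trans (pN _) (AB (x, y) _).
have Re_sub : {morph @complex.Re R : x y / x - y} by case=> ? ? [].
have Im_sub : {morph @complex.Im R : x y / x - y} by case=> ? ? [].
have Re_le (z : R[i]) : (`|complex.Re z|)%:C%C <= `|z|.
  by rewrite normc_def lecR -sqrtr_sqr ler_wsqrtr// lerDl sqr_ge0.
have Im_le (z : R[i]) : (`|complex.Im z|)%:C%C <= `|z|.
  by rewrite normc_def lecR -sqrtr_sqr ler_wsqrtr// lerDr sqr_ge0.
have /cvg_ex[a Fa] := part_cvg _ Re_sub Re_le.
have /cvg_ex[b Fb] := part_cvg _ Im_sub Im_le.
apply/cvg_ex; exists (a +i* b)%C; apply/cvgrPdist_lt => e e0.
have eE : e = (complex.Re e)%:C%C by rewrite RRe_real// gtr0_real.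
have e2 : 0 < complex.Re e / 2 by rewrite divr_gt0// -ltcR -eE.
move/cvgrPdist_lt : Fa => /(_ _ e2) Fa; move/cvgrPdist_lt : Fb => /(_ _ e2) Fb.
near=> z; apply: le_lt_trans (norm_le _) _; rewrite eE ltcR [ltRHS]splitr.
have za : `|a - complex.Re z| < complex.Re e / 2 by near: z.
have zb : `|b - complex.Im z| < complex.Re e / 2 by near: z.
by case: (z) za zb => z1 z2 /= za zb; exact: ltrD.
Unshelve. all: by end_near. Qed.

End ScalarField.

Definition separable_space (T : topologicalType) : Prop :=
  exists2 D : set T, countable D & dense D.

Section Dual.
Variables (R : realType) (k : scalar_kind).
Local Notation K := (scalar_field R k).
Variable X : normedModType K.

Definition continuous_linear : {pred X -> K^o} :=
  [pred f | `[< linear f /\ continuous f >]].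

Record dual := Dual {
  dual_fun :> X -> K^o;
  _ : dual_fun \in continuous_linear }.

HB.instance Definition _ := [isSub for dual_fun].
HB.instance Definition _ := [Choice of dual by <:].

Lemma continuous_linear_submod : submod_closed continuous_linear.
Proof.
split; first by apply/asboolP; split=> [a x y|x] /=;
  [rewrite addr0 scaler0|exact: cvg_cst].
move=> a f g /asboolP[fl fc] /asboolP[gl gc]; apply/asboolP; split.
  move=> b x y; rewrite !fctE fl gl !scalerDr !scalerA (mulrC a b).
  by rewrite addrACA.
by move=> x; apply: cvgD; [apply: cvgZr|]; [exact: fc|exact: gc].
Qed.

HB.instance Definition _ := GRing.isSubmodClosed.Build K (X -> K^o)
  continuous_linear continuous_linear_submod.
HB.instance Definition _ := [SubChoice_isSubLmodule of dual by <:].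

Lemma dual_linear (f : dual) : linear f.
Proof. by case: f => f /= /asboolP[]. Qed.

Lemma dual_continuous (f : dual) : continuous f.
Proof. by case: f => f /= /asboolP[]. Qed.

HB.instance Definition _ (f : dual) :=
  @GRing.isLinear.Build K X K^o _ (dual_fun f) (dual_linear f).

(* [supremum] is the least upper bound for the partial order of the scalars,
   where a least upper bound of moduli is a real number. *)
Definition dual_norm (f : dual) : K :=
  supremum 0 [set `|f x| | x in [set x : X | `|x| <= 1]].

Lemma dual_norm_supremums (f : dual) :
  supremums [set `|f x| | x in [set x : X | `|x| <= 1]] (dual_norm f).
Proof.
set A := (X in supremums X _); have A0 : A !=set0.
  by exists `|f 0|, 0 => //=; rewrite normr0.
rewrite /dual_norm -/A /supremum; case: ifPn => [/eqP A00|_].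
  by move: A0; rewrite A00 => -[].
have /linear_boundedP/pinfty_ex_gt0[M M0 fM] : bounded_near f (nbhs (0 : X)).
  exact/linear_bounded_continuous/dual_continuous.
have [s As] : supremums A !=set0.
  apply: (@scalar_supremums _ _ A M) => //.
    by move=> _ [x _ <-] /=.
  by move=> _ [x /= x1 <-]; rewrite (le_trans (fM x))// ler_piMr// ltW.
exact: xgetI As.
Qed.

Lemma dual_norm_ub (f : dual) (x : X) : `|x| <= 1 -> `|f x| <= dual_norm f.
Proof. by move=> x1; apply: (dual_norm_supremums f).1; exists x. Qed.

Lemma dual_norm_lub (f : dual) (M : K) :
  (forall x : X, `|x| <= 1 -> `|f x| <= M) -> dual_norm f <= M.
Proof. by move=> fM; apply: (dual_norm_supremums f).2 => _ [x x1 <-]; exact: fM. Qed.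

Lemma dual_norm_ge0 (f : dual) : 0 <= dual_norm f.
Proof. by apply: le_trans (@dual_norm_ub f 0 _); rewrite ?normr0. Qed.

Lemma dual_norm_le (f : dual) (x : X) : `|f x| <= dual_norm f * `|x|.
Proof.
have [->|x0] := eqVneq x 0; first by rewrite linear0 !normr0 mulr0.
have nx0 : 0 < `|x| by rewrite normr_gt0.
rewrite -ler_pdivrMr// mulrC -[X in X * _]gtr0_norm ?invr_gt0//.
rewrite -normrZ -linearZ dual_norm_ub// normrZ gtr0_norm ?invr_gt0//.
by rewrite mulVf// gt_eqF.
Qed.

Lemma dual_normD (f g : dual) : dual_norm (f + g) <= dual_norm f + dual_norm g.
Proof.
apply: dual_norm_lub => x x1; apply: le_trans (ler_normD _ _) _.
by rewrite lerD// dual_norm_ub.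
Qed.

Lemma dual_normZ (a : K) (f : dual) : dual_norm (a *: f) = `|a| * dual_norm f.
Proof.
have le_normZ b g : dual_norm (b *: g) <= `|b| * dual_norm g.
  apply: dual_norm_lub => x x1.
  by rewrite normrZ ler_wpM2l// dual_norm_ub.
apply/eqP; rewrite eq_le le_normZ /=.
have [->|a0] := eqVneq a 0; first by rewrite normr0 mul0r dual_norm_ge0.
rewrite mulrC -ler_pdivlMr ?normr_gt0// mulrC -normfV.
by apply: le_trans (le_normZ _ _); rewrite scalerA mulVf// scale1r.
Qed.

Lemma dual_norm0_eq0 (f : dual) : dual_norm f = 0 -> f = 0.
Proof.
move=> f0; apply/val_inj/funext => x; apply/eqP; rewrite -normr_le0.
by have := dual_norm_le f x; rewrite f0 mul0r.
Qed.

HB.instance Definition _ := Lmodule_isNormed.Build K dual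
  dual_normD dual_normZ dual_norm0_eq0.

(* The weak* topology w(X^*, X) is pointwise convergence on X; the norm
   topology is the one carried by [dual] itself. *)
Definition weak_star : Type :=
  initial_topology (dual_fun : dual -> {ptws X -> K^o}).

HB.instance Definition _ := Topological.on weak_star.

Definition weak_star_closure (A : set dual) : set dual :=
  closure (A : set weak_star).

Definition dual_unit_ball : set dual := [set f | `|f| < 1].

Definition balanced (U : set dual) : Prop :=
  forall (t : K) (f : dual), `|t| <= 1 -> U f -> U (t *: f).

(* The last clause says that B has positive distance to the complement of U;
   it holds vacuously when U is the whole dual. *)
Definition bounded_relative_to (U B : set dual) : Prop :=
  [/\ B `<=` U, bounded_set B &
      exists2 e : K, 0 < e & forall f g : dual, B f -> ~ U g -> e <= `|f - g|].

Definition envelope (U : set dual) : set dual :=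
  \bigcup_(B in [set B | bounded_relative_to U B]) weak_star_closure B.

Definition dense_envelope_fixed (U : set dual) : Prop :=
  [/\ open U, balanced U, U `<` dual_unit_ball, envelope U = U &
      dual_unit_ball `<=` weak_star_closure U].

End Dual.

Section EllOne.
Variables (R : realType) (k : scalar_kind).
Local Notation K := (scalar_field R k).

Definition abs_summable : {pred nat -> K^o} :=
  [pred x : nat -> K^o | `[< cvgn [normed series x] >]].

Record ell1 := Ell1 {
  ell1_fun :> nat -> K^o;
  _ : ell1_fun \in abs_summable }.

HB.instance Definition _ := [isSub for ell1_fun].
HB.instance Definition _ := [Choice of ell1 by <:].

Lemma normed_series_ge0 (x : nat -> K^o) n : 0 <= [normed series x] n.
Proof. by rewrite /= /series/= sumr_ge0. Qed.

Lemma nondecreasing_normed_series (x : nat -> K^o) :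
  nondecreasing_seq [normed series x].
Proof. by apply: nondecreasing_series => n _ _; exact: normr_ge0. Qed.

Lemma abs_summableP (x : nat -> K^o) : x \in abs_summable <->
  exists M : K, forall n, [normed series x] n <= M.
Proof.
split=> [/asboolP xc|[M xM]]; last first.
  have [||//|s [xs _ _]] := @scalar_nondecreasing_cvg R k [normed series x] M.
  - exact: normed_series_ge0.
  - exact: nondecreasing_normed_series.
  by apply/asboolP/cvg_ex; exists s.
have /pinfty_ex_gt0[M _ xM] := cvg_seq_bounded xc.
exists M => n; apply: le_trans (xM n I).
by rewrite [leRHS]ger0_norm ?normed_series_ge0.
Qed.

Lemma abs_summable_submod : submod_closed abs_summable.
Proof.
split; first by apply/abs_summableP; exists 0 => n /=;
  rewrite /series/= big1// => i _; rewrite normr0.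
move=> a x y /abs_summableP[M xM] /abs_summableP[N yN].
apply/abs_summableP; exists (`|a| * M + N) => n /=.
apply: le_trans (_ : `|a| * [normed series x] n + [normed series y] n <= _).
  rewrite /= /series/= mulr_sumr -big_split/=; apply: ler_sum => i _.
  by rewrite (le_trans (ler_normD _ _))// normrZ.
by rewrite lerD// ler_wpM2l.
Qed.

HB.instance Definition _ := GRing.isSubmodClosed.Build K (nat -> K^o)
  abs_summable abs_summable_submod.
HB.instance Definition _ := [SubChoice_isSubLmodule of ell1 by <:].

Definition ell1_norm (x : ell1) : K := limn [normed series x].

Lemma ell1_normP (x : ell1) :
  [/\ [normed series x] @ \oo --> ell1_norm x,
    forall n, [normed series x] n <= ell1_norm x &
    forall M, (forall n, [normed series x] n <= M) -> ell1_norm x <= M].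
Proof.
case: x => x xP; have /abs_summableP[M xM] := xP.
have [||//|s [xs us ls]] := @scalar_nondecreasing_cvg R k [normed series x] M.
- exact: normed_series_ge0.
- exact: nondecreasing_normed_series.
have -> : ell1_norm (Ell1 xP) = s by exact: (@cvg_lim K^o (@norm_hausdorff _ _)).
by split.
Qed.

Lemma ell1_norm_cvg (x : ell1) : [normed series x] @ \oo --> ell1_norm x.
Proof. by have [] := ell1_normP x. Qed.

Lemma ell1_norm_ub (x : ell1) n : [normed series x] n <= ell1_norm x.
Proof. by have [] := ell1_normP x. Qed.

Lemma ell1_norm_lub (x : ell1) (M : K) :
  (forall n, [normed series x] n <= M) -> ell1_norm x <= M.
Proof. by have [_ _] := ell1_normP x; apply. Qed.

Lemma ell1_norm_ge0 (x : ell1) : 0 <= ell1_norm x.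
Proof. by apply: le_trans (ell1_norm_ub x 0%N); exact: normed_series_ge0. Qed.

Lemma ell1_coord_le (x : ell1) n : `|x n| <= ell1_norm x.
Proof.
apply: le_trans (ell1_norm_ub x n.+1).
by rewrite /= /series/= big_nat_recr//= lerDr sumr_ge0.
Qed.

Lemma ell1_normD (x y : ell1) : ell1_norm (x + y) <= ell1_norm x + ell1_norm y.
Proof.
apply: ell1_norm_lub => n.
apply: le_trans (lerD (ell1_norm_ub x n) (ell1_norm_ub y n)).
by rewrite /= /series/= -big_split/=; apply: ler_sum => i _; exact: ler_normD.
Qed.

Lemma ell1_normZ (a : K) (x : ell1) : ell1_norm (a *: x) = `|a| * ell1_norm x.
Proof.
apply: (@cvg_lim K^o (@norm_hausdorff _ _)).
have -> : [normed series (a *: x)] = (fun n => `|a| * [normed series x] n).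
  apply/funext => n; rewrite /= /series/= mulr_sumr; apply: eq_bigr => i _.
  by rewrite -normrZ.
by apply: cvgMr; exact: ell1_norm_cvg.
Qed.

Lemma ell1_norm0_eq0 (x : ell1) : ell1_norm x = 0 -> x = 0.
Proof.
move=> x0; apply/val_inj/funext => n; apply/eqP; rewrite -normr_le0 -x0.
exact: ell1_coord_le.
Qed.

HB.instance Definition _ := Lmodule_isNormed.Build K ell1
  ell1_normD ell1_normZ ell1_norm0_eq0.

Lemma ell1_complete (F : set_system ell1) : ProperFilter F -> cauchy F -> cvg F.
Proof.
move=> FF Fc.
have coord_cvg n : exists a : K^o, (fun x : ell1 => x n) @ F --> a.
  apply/cvg_ex; apply: scalar_complete; apply/cauchy_ballP => e e0.
  have /cauchy_ballP/(_ _ e0)[[A B] /= [FA FB] AB] := Fc.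
  exists ((fun x : ell1 => x n) @` A, (fun x : ell1 => x n) @` B) => /=.
    by split; [apply: filterS FA|apply: filterS FB] => x Ax /=; exists x.
  move=> [_ _] /= [[x Ax <-] [y By <-]].
  have := AB (x, y) (conj Ax By); rewrite -!ball_normE /=.
  by apply: le_lt_trans; exact: (ell1_coord_le (x - y)).
have [y xy] := choice coord_cvg.
have near_sum n (d : K) : 0 < d ->
    \forall z \near F, [normed series (y - (z : ell1) : nat -> K^o)] n < d.
  elim: n d => [|n IHn] d d0.
    by apply: nearW => z; rewrite /= /series/= big_nil.
  have d2 : 0 < d / 2 by rewrite divr_gt0.
  have /cvgrPdist_lt/(_ _ d2) yn := xy n.
  near=> z; rewrite /= /series/= big_nat_recr//= [ltRHS]splitr ltrD//.
    by near: z; exact: IHn.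
  by near: z; exact: yn.
have near_y (e : K) : 0 < e -> \forall x \near F,
    forall n, [normed series (y - (x : ell1) : nat -> K^o)] n <= e.
  move=> e0; have /cauchy_ballP/(_ _ e0)[[A B] /= [FA FB] AB] := Fc.
  apply: filterS FB => x Bx n; apply/ler_addgt0Pr => d d0.
  near F => z.
  have Az : A z by near: z.
  have := AB (z, x) (conj Az Bx); rewrite -ball_normE /= => zx.
  have yz : [normed series (y - z : nat -> K^o)] n < d.
    by near: z; exact: near_sum.
  rewrite [leRHS]addrC; apply: le_trans (lerD (ltW yz) (ltW zx)).
  apply: le_trans (lerD (lexx _) (ell1_norm_ub (z - x) n)).
  rewrite /= /series/= -big_split/=; apply: ler_sum => i _.
  by rewrite -[X in `|X|](subrKA (z i)) ler_normD.
have yP : y \in abs_summable.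
  have [x xe] := filter_ex (near_y 1 ltr01).
  apply/abs_summableP; exists (1 + ell1_norm x) => n.
  apply: le_trans (lerD (xe n) (ell1_norm_ub x n)).
  rewrite /= /series/= -big_split/=; apply: ler_sum => i _.
  by rewrite -[X in `|X|](subrK (x i)) ler_normD.
apply/cvg_ex; exists (Ell1 yP); apply/cvgrPdist_le => e e0.
by apply: filterS (near_y e e0) => x xe; exact: ell1_norm_lub.
Unshelve. all: by end_near. Qed.

HB.instance Definition _ := Uniform_isComplete.Build ell1 ell1_complete.

Definition ell1_pairing (a : nat -> K^o) (f : dual ell1) : Prop :=
  forall x : ell1, [series a n * x n]_n @ \oo --> f x.

(* Via the canonical pairing, which is linear in the sequence, the dual of ell1
   is isometrically the space of bounded sequences with the sup norm. *)
Definition dual_ell1_is_ellinfty : Prop :=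
  [/\ forall a, bounded_fun a -> exists f : dual ell1, ell1_pairing a f,
      forall f, exists2 a, bounded_fun a & ell1_pairing a f &
      forall a f, bounded_fun a -> ell1_pairing a f ->
        `|f| = supremum 0 (range (fun n => `|a n|))].

End EllOne.

(* Main.v *)
Require Import Defs.
From HB Require Import structures.
From mathcomp Require Import all_boot all_order all_algebra.
From mathcomp Require Import all_classical all_reals all_analysis.
From mathcomp Require Import complex.

Set Implicit Arguments.
Unset Strict Implicit.
Unset Printing Implicit Defensive.

Import Order.TTheory GRing.Theory Num.Def Num.Theory.
Import numFieldNormedType.Exports.

Local Open Scope classical_set_scope.
Local Open Scope ring_scope.

(** Let [U] be the set of [f] in the open unit ball such that, for some [n], the
    moduli [`|f e_j|], [j >= n], have an upper bound smaller than [1/(n+2)].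
    If all perturbations of [f] of norm at most [s] are in [U], then increasing
    the modulus of every coordinate by [s] shows that [s < 1/(n+2)] for the [n]
    in question, which leaves finitely many [n].  Hence a [U]-bounded set lies
    in a finite union of subsets of [U] that are weak* closed because they are
    cut out by bounds on the moduli of the coordinates.  Finitely supported
    sequences make [U] weak* dense, and the constant sequence [1/2] is not in
    [U]. *)

(** * Real and complex scalars: the Archimedean property and a dense sequence *)

Section Scalars.
Variables (R : realType) (k : scalar_kind).
Local Notation K := (scalar_field R k).

(** A positive complex scalar is real, so both cases reduce to the real field. *)
Lemma scalar_archimedean (e : K) : 0 < e ->
  exists N, forall n, (N <= n)%N -> n.+2%:R^-1 < e.
Proof.
have real_archimedean (r : R) : 0 < r ->
    exists N, forall n, (N <= n)%N -> n.+2%:R^-1 < r.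
  move=> r0; exists (Num.bound r^-1) => n Nn.
  rewrite invf_plt ?posrE// (lt_le_trans (archi_boundP _)) ?invr_ge0 ?ltW//.
  by rewrite ltr_nat ltnS (leq_trans Nn).
case: k e => e e0; first exact: real_archimedean.
have eE : e = (complex.Re e)%:C%C by rewrite RRe_real// gtr0_real.
have [|N NP] := real_archimedean (complex.Re e); first by rewrite -ltcR -eE.
by exists N => n /NP; rewrite -ltcR -eE fmorphV rmorph_nat.
Qed.

(** An enumeration, rather than a countable set, lets finite lists of indices code finitely
    supported sequences. *)
Lemma scalar_countable_dense : exists q : nat -> K,
  forall (x e : K), 0 < e -> exists n, `|x - q n| < e.
Proof.
have ratP (x r : R) : 0 < r -> exists a : rat, `|x - ratr a| < r.
  move=> r0; have xr : x - r < x + r by rewrite ltrD2l gtrN.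
  have [a] := rat_in_itvoo xr.
  by rewrite in_itv/= -ltr_distlC => xa; exists a.
pose qr n : R := if @unpickle rat n is Some a then ratr a else 0.
have qrP (x r : R) : 0 < r -> exists n, `|x - qr n| < r.
  by move=> /ratP-/(_ x)[a xa]; exists (pickle a); rewrite /qr pickleK.
case: k => /=; first by exists qr.
pose qc n : R[i] :=
  if @unpickle (nat * nat)%type n is Some p then (qr p.1 +i* qr p.2)%C else 0.
exists qc => x e e0.
have eE : e = (complex.Re e)%:C%C by rewrite RRe_real// gtr0_real.
have e2 : 0 < complex.Re e / 2 by rewrite divr_gt0// -ltcR -eE.
have [m xm] := qrP (complex.Re x) _ e2; have [n xn] := qrP (complex.Im x) _ e2.
exists (pickle (m, n)); rewrite /qc pickleK/=.
case: x xm xn => a b /= xm xn.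
have -> : ((a +i* b) - (qr m +i* qr n))%C = (a - qr m)%:C%C + (b - qr n)*i%C.
  by apply/eqP; rewrite eq_complex/= addr0 add0r !eqxx.
rewrite (le_lt_trans (ler_normD _ _))// !normc_def/= !expr0n/= add0r addr0.
rewrite !sqrtr_sqr -rmorphD/= eE ltcR [ltRHS]splitr.
exact: ltrD.
Qed.

End Scalars.

(** * Weak* closures in the dual of a normed space *)

Section WeakStar.
Variables (R : realType) (k : scalar_kind).
Local Notation K := (scalar_field R k).
Variable X : normedModType K.

(** Weak* open sets are preimages of open sets for pointwise convergence, so a pointwise convergent
    sequence meets each neighbourhood of its limit. *)
Lemma weak_star_closure_cvg (A : set (dual X)) (u : nat -> dual X)
    (f : dual X) :
  (forall n, A (u n)) -> (forall x, u n x @[n --> \oo] --> f x) ->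
  weak_star_closure A f.
Proof.
move=> Au uf B; rewrite nbhsE => -[W [[V oV VW] Wf]] WB.
have uV : {ptws, (@dual_fun R k X \o u : nat -> X -> K^o) @ \oo -->
    (f : X -> K^o)}.
  by apply/pointwise_cvgP => x; exact: uf.
have [n nV] : exists n, V (u n).
  apply: (@filter_ex _ (nbhs \oo)); apply: uV; apply: open_nbhs_nbhs.
  by split=> //; move: Wf; rewrite -VW.
by exists (u n); split=> //; apply: WB; rewrite -VW.
Qed.

Lemma weak_star_eval_continuous (x : X) :
  continuous (fun f : weak_star X => (f : dual X) x : K^o).
Proof.
move=> f.
apply: (@continuous_comp (weak_star X) {ptws X -> K^o} K^o
    (@dual_fun R k X) (fun g => g x)).
  exact: initial_continuous.
exact: (@proj_continuous X (fun=> K^o) x).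
Qed.

(** Evaluation at [x] is weak* continuous, so bounds on [|g x|] survive weak* limits. *)
Lemma weak_star_closure_norm_le (A : set (dual X)) (x : X) (c : K)
    (f : dual X) :
  (forall g, A g -> `|g x| <= c) -> weak_star_closure A f -> `|f x| <= c.
Proof.
move=> Ac Af; apply/ler_addgt0Pr => d d0.
have /cvgrPdist_lt/(_ _ d0) fd := @weak_star_eval_continuous x f.
have [g [Ag fg]] := Af _ fd.
rewrite -[X in `|X|](subrK (g x)) [leRHS]addrC.
by rewrite (le_trans (ler_normD _ _))// lerD ?Ac// ltW.
Qed.

(** When [U] is open, each singleton in [U] is [U]-bounded. *)
Lemma sub_envelope (U : set (dual X)) : open U -> U `<=` envelope U.
Proof.
move=> oU f Uf; exists [set f]; last exact: subset_closure.
have /nbhs_ballP[e /= e0 eU] := open_nbhs_nbhs (conj oU Uf).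
split; first by move=> _ ->.
  exists `|f|; split=> // M fM _ ->; exact: ltW.
exists e => // _ g -> Ug.
have : ~ (`|f - g| < e) by move=> fg; apply: Ug; apply: eU; rewrite -ball_normE.
have er := gtr0_real e0.
by rewrite real_leNgt ?normr_real// => /negP.
Qed.

End WeakStar.

(** * Truncations and unit vectors in [ell1] *)

Section EllOne.
Variables (R : realType) (k : scalar_kind).
Local Notation K := (scalar_field R k).
Local Notation ell1 := (ell1 R k).

Lemma abs_summable_finite (m : nat) (a : nat -> K^o) :
  ((fun i => if (i < m)%N then a i else 0) : nat -> K^o)
    \in @abs_summable R k.
Proof.
apply/abs_summableP; exists (\sum_(0 <= i < m) `|a i|) => n.
(* The range up to [m + n] can be split both at [n] and at [m] without comparing the two. *)
apply: (@le_trans _ _ (\sum_(0 <= i < m + n)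
    `|if (i < m)%N then a i else 0|)).
  rewrite /= /series/= addnC (@big_cat_nat _ _ _ n 0%N (n + m)) ?leq_addr//=.
  by rewrite lerDl sumr_ge0.
rewrite (@big_cat_nat _ _ _ m 0%N (m + n)) ?leq_addr//= addrC big_nat big1.
  by rewrite add0r big_nat [leRHS]big_nat; apply: ler_sum => i /andP[_ ->].
by move=> i /andP[mi _]; rewrite ltnNge mi normr0.
Qed.

Definition ell1_finite m a : ell1 := Ell1 (abs_summable_finite m a).

Definition ell1_unit n : ell1 := ell1_finite n.+1 (fun i => (i == n)%:R).

Lemma ell1_finiteE m (a : nat -> K^o) i :
  ell1_finite m a i = if (i < m)%N then a i else 0.
Proof. by []. Qed.

Lemma ell1_unitE n i : ell1_unit n i = (i == n)%:R.
Proof. by rewrite ell1_finiteE ltnS; case: ltngtP. Qed.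

Lemma ell1_finite_sum m (a : nat -> K^o) :
  ell1_finite m a = \sum_(0 <= i < m) a i *: ell1_unit i.
Proof.
apply/val_inj/funext => j.
have -> (s : seq nat) : val (\sum_(i <- s) a i *: ell1_unit i) j =
    \sum_(i <- s) a i * (j == i)%:R.
  elim: s => [|i s IHs]; first by rewrite !big_nil.
  by rewrite !big_cons -IHs -ell1_unitE.
rewrite /= big_mkord; case: ltnP => [jm|mj].
  rewrite (bigD1 (Ordinal jm))//= eqxx mulr1 big1 ?addr0// => i.
  by rewrite -val_eqE/= eq_sym => /negPf ->; rewrite mulr0.
by rewrite big1// => i _; rewrite gtn_eqF ?mulr0// (leq_trans _ mj).
Qed.

Lemma ell1_unit_norm_le n : `|ell1_unit n| <= 1.
Proof.
apply: ell1_norm_lub => m; rewrite /= /series/=.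
apply: (@le_trans _ _ (\sum_(0 <= i < m) (i == n)%:R)).
  apply: ler_sum => i _; rewrite ltnS.
  by case: (ltngtP i n) => _ /=; rewrite ?normr0 ?normr1.
rewrite big_mkord -natr_sum lern1.
have [nm|mn] := ltnP n m; last first.
  by rewrite big1// => i _; rewrite ltn_eqF// (leq_trans _ mn).
rewrite (bigD1 (Ordinal nm))//= eqxx big1// => i.
by rewrite -val_eqE/= => /negPf ->.
Qed.

Lemma ell1_tail_norm_le (x : ell1) m :
  `|x - ell1_finite m x| <= `|x| - [normed series x] m.
Proof.
apply: ell1_norm_lub => n; rewrite lerBrDr.
apply: le_trans (ell1_norm_ub x (m + n)).
set g := (val (x - _)).
have gE i : g i = x i - (if (i < m)%N then x i else 0) by [].
rewrite /= /series/=.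
apply: (@le_trans _ _ (\sum_(0 <= i < m + n) `|g i| +
    \sum_(0 <= i < m) `|x i|)).
  rewrite lerD2r addnC [leRHS](@big_cat_nat _ _ _ n 0%N (n + m)) ?leq_addr//=.
  by rewrite lerDl sumr_ge0.
rewrite (@big_cat_nat _ _ _ m 0%N (m + n)) ?leq_addr//=.
rewrite [leRHS](@big_cat_nat _ _ _ m 0%N (m + n)) ?leq_addr//=.
rewrite [leRHS]addrC lerD2r.
rewrite big_nat big1 ?add0r => [|i /andP[_ im]]; last first.
  by rewrite gE im subrr normr0.
rewrite big_nat [leRHS]big_nat; apply: ler_sum => i /andP[mi _].
by rewrite gE ltnNge mi subr0.
Qed.

Lemma ell1_finite_cvg (x : ell1) : ell1_finite m x @[m --> \oo] --> x.
Proof.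
apply/cvgrPdist_lt => e e0.
have /cvgrPdist_lt/(_ _ e0) := ell1_norm_cvg (x := x).
apply: filterS => m; apply: le_lt_trans.
apply: le_trans (ell1_tail_norm_le x m) _.
by rewrite ger0_norm// subr_ge0 ell1_norm_ub.
Qed.

(** * Duality between [ell1] and bounded sequences *)

Lemma ell1_pairing_units (f : dual ell1) :
  ell1_pairing (fun n => f (ell1_unit n)) f.
Proof.
(* The partial sums are the values of [f] at truncations of [x], which converge to [x] in norm. *)
move=> x; rewrite (_ : [series _]_n = fun m => f (ell1_finite m x)).
  apply: (@continuous_cvg _ _ _ _ _ (@ell1_finite ^~ x) f).
    exact: dual_continuous.
  exact: ell1_finite_cvg.
apply/funext => m; rewrite ell1_finite_sum linear_sum; apply: eq_bigr => i _.
by rewrite linearZ; exact: mulrC.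
Qed.

(** At a unit vector the series is eventually constant; hence a functional determines its
    sequence. *)
Lemma ell1_pairing_unit (a : nat -> K^o) (f : dual ell1) n :
  ell1_pairing a f -> f (ell1_unit n) = a n.
Proof.
move=> /(_ (ell1_unit n)) /(cvg_lim (@norm_hausdorff _ _)) <-.
apply: lim_near_cst; first exact: norm_hausdorff.
near=> m; rewrite /series/= big_mkord.
have nm : (n < m)%N by near: m; exact: nbhs_infty_gt.
rewrite (bigD1 (Ordinal nm))//= ltnSn eqxx mulr1 big1 ?addr0// => i.
by rewrite -val_eqE/= => /negPf ->; rewrite if_same mulr0.
Unshelve. all: by end_near. Qed.

(** Hölder's inequality for partial sums, passed to the limit. Speaking of a limit [l] instead of a
    functional makes it available already for the continuity of the functional built from [a]. *)
Lemma bounded_pairing_lim_le (a : nat -> K^o) (M : K) (x : ell1) (l : K^o) :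
  (forall n, `|a n| <= M) -> [series a n * x n]_n @ \oo --> l ->
  `|l| <= M * `|x|.
Proof.
move=> aM al; apply/ler_addgt0Pr => d d0.
have /cvgrPdist_lt/(_ _ d0)/filter_ex[m lm] := al.
rewrite -[X in `|X|](subrK ([series a n * x n]_n m)).
rewrite [leRHS]addrC (le_trans (ler_normD _ _))// lerD ?(ltW lm)//.
have M0 : 0 <= M by exact: le_trans (aM 0%N).
apply: le_trans (ler_wpM2l M0 (ell1_norm_ub x m)).
rewrite /= /series/= mulr_sumr; apply: le_trans (ler_norm_sum _ _ _) _.
by apply: ler_sum => i _; rewrite normrM ler_wpM2r.
Qed.

Lemma bounded_pairing_cvg (a : nat -> K^o) (M : K) (x : ell1) :
  (forall n, `|a n| <= M) -> cvgn [series a n * x n]_n.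
Proof.
move=> aM; apply: scalar_complete; apply/cauchy_seriesP => e e0.
have M0 : 0 <= M by exact: le_trans (aM 0%N).
(* [M] may be zero, so [M + 1] serves as the divisor. *)
have M1 : 0 < M + 1 by rewrite ltr_wpDl.
have eM : 0 < e / (M + 1) by exact: divr_gt0.
have xc : cvgn [normed series x].
  by apply/cvg_ex; exists (ell1_norm x); exact: ell1_norm_cvg.
have /cvg_cauchy/cauchy_seriesP/(_ _ eM) := xc.
apply: filterS => -[m n] /= xmn.
apply: (@le_lt_trans _ _ (M * \sum_(m <= i < n) `|x i|)).
  rewrite mulr_sumr; apply: le_trans (ler_norm_sum _ _ _) _.
  by apply: ler_sum => i _; rewrite normrM ler_wpM2r.
rewrite ger0_norm ?sumr_ge0// ltr_pdivlMr// mulrC in xmn.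
by apply: le_lt_trans xmn; rewrite ler_wpM2r ?sumr_ge0// lerDl.
Qed.

Lemma bounded_pairing_exists (a : nat -> K^o) (M : K) :
  (forall n, `|a n| <= M) -> exists f : dual ell1, ell1_pairing a f.
Proof.
move=> aM; pose f (x : ell1) : K^o := limn [series a n * x n]_n.
have fP (x : ell1) : [series a n * x n]_n @ \oo --> f x.
  exact: bounded_pairing_cvg aM.
have fl : linear f.
  move=> c x y; apply: cvg_lim; first exact: norm_hausdorff.
  rewrite (_ : [series _]_n =
      c *: [series a n * x n]_n + [series a n * y n]_n).
    by apply: cvgD (fP y); apply: cvgZr; exact: fP.
  apply/funext => n; rewrite /series/= !fctE scaler_sumr -big_split.
  by apply: eq_bigr => i _ /=; rewrite mulrDr/= mulrCA.
have M0 : 0 <= M by exact: le_trans (aM 0%N).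
pose F := GRing.isLinear.Build K ell1 K^o _ f fl.
pose g : {linear ell1 -> K^o} := HB.pack f F.
have fc : continuous g.
  apply: bounded_linear_continuous; apply/linear_boundedP.
  near=> r => x.
  apply: le_trans (bounded_pairing_lim_le aM (fP x)) _.
  by rewrite ler_wpM2r//; near: r; apply: nbhs_pinfty_ge; exact: ger0_real.
have fP' : f \in @continuous_linear R k ell1 by apply/asboolP.
by exists (Dual fP').
Unshelve. all: by end_near. Qed.

Lemma bounded_pairing_dual_norm_le (a : nat -> K^o) (M : K) (f : dual ell1) :
  (forall n, `|a n| <= M) -> ell1_pairing a f -> `|f| <= M.
Proof.
move=> aM af; have M0 : 0 <= M by exact: le_trans (aM 0%N).
apply: dual_norm_lub => x x1.
apply: le_trans (bounded_pairing_lim_le aM (af x)) _.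
by rewrite ler_piMr.
Qed.

Lemma dual_ell1_norm_le (f : dual ell1) (M : K) :
  (forall n, `|f (ell1_unit n)| <= M) -> `|f| <= M.
Proof.
move=> fM.
exact: (@bounded_pairing_dual_norm_le _ M f fM (@ell1_pairing_units f)).
Qed.

Lemma dual_ell1_unit_le (f : dual ell1) n : `|f (ell1_unit n)| <= `|f|.
Proof. exact/dual_norm_ub/ell1_unit_norm_le. Qed.

Lemma dual_ell1_ellinfty : dual_ell1_is_ellinfty R k.
Proof.
split.
- move=> a /pinfty_ex_gt0[M _ aM]; apply: (@bounded_pairing_exists a M) => n.
  exact: aM.
- move=> f; exists (fun n => f (ell1_unit n)); last exact: ell1_pairing_units.
  exists `|f|; split=> [|M fM n _]; first exact: normr_real.
  by apply: le_trans (ltW fM); exact: dual_ell1_unit_le.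
- move=> a f _ af; set A := (X in supremum _ X).
  have A0 : A !=set0 by exists `|a 0%N|, 0%N.
  have Af : supremums A `|f|.
    split=> [_ [n _ <-]|M AM].
      by rewrite -(ell1_pairing_unit n af); exact: dual_ell1_unit_le.
    by apply: (@bounded_pairing_dual_norm_le a) => // n; apply: AM; exists n.
  (* The default value [0] concerns only the empty set; otherwise uniqueness of least upper bounds
     identifies the chosen one with [|f|]. *)
  rewrite /supremum; case: ifPn => [/eqP A00|_].
    by move: A0; rewrite A00 => -[].
  by apply: (@is_subset1_supremums _ _ A) => //; exact: xgetI Af.
Qed.

(** * Separability of [ell1] *)

Lemma ell1_finite_norm_le m (a : nat -> K^o) :
  `|ell1_finite m a| <= \sum_(0 <= i < m) `|a i|.
Proof.
rewrite ell1_finite_sum; apply: le_trans (ler_norm_sum _ _ _) _.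
by apply: ler_sum => i _; rewrite normrZ ler_piMr// ell1_unit_norm_le.
Qed.

Lemma ell1_finiteB m (a b : nat -> K^o) :
  ell1_finite m a - ell1_finite m b = ell1_finite m (fun i => a i - b i).
Proof.
by rewrite !ell1_finite_sum -sumrB; apply: eq_bigr => i _; rewrite scalerBl.
Qed.

Lemma ell1_separable : separable_space ell1.
Proof.
have [q qP] := scalar_countable_dense R k.
(* A list of indices codes the finitely supported sequence of the corresponding values of [q]; there
   are countably many lists. *)
pose d (s : seq nat) := ell1_finite (size s) (fun i => q (nth 0%N s i)).
exists (range d); first exact: sub_countable (card_image_le _ _) (countableP _).
move=> V [x Vx] oV.
have /nbhs_ballP[e /= e0 eV] := open_nbhs_nbhs (conj oV Vx).
have e2 : 0 < e / 2 by rewrite divr_gt0.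
have /cvgrPdist_lt/(_ _ e2)/filter_ex[m xm] := ell1_finite_cvg (x := x).
(* The error [e / 2] is shared among [m] coordinates; dividing by [m.+1] also covers [m = 0]. *)
have em : 0 < e / 2 / m.+1%:R by rewrite divr_gt0.
have [c xc] := choice (fun i => qP (x i) _ em).
exists (d (mkseq c m)); split; last by exists (mkseq c m).
apply: eV; rewrite -ball_normE /= [ltRHS]splitr.
rewrite -[X in `|X|](subrKA (ell1_finite m x)).
rewrite (le_lt_trans (ler_normD _ _))// ltr_leD//.
rewrite /d size_mkseq ell1_finiteB; apply: le_trans (ell1_finite_norm_le _ _) _.
apply: (@le_trans _ _ (\sum_(0 <= i < m) e / 2 / m.+1%:R)).
  rewrite big_nat [leRHS]big_nat; apply: ler_sum => i /andP[_ im].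
  by rewrite nth_mkseq// ltW.
rewrite sumr_const_nat subn0 -[leLHS]mulr_natl mulrCA ler_piMr ?ltW//.
by rewrite ltr_pdivrMr// mul1r ltr_nat.
Qed.

(** * The set of functionals with small tails: openness, envelope and weak* density *)

Lemma finite_pairingE m (a : nat -> K^o) (f : dual ell1) (x : ell1) :
  ell1_pairing (fun i => if (i < m)%N then a i else 0) f ->
  f x = [series a n * x n]_n m.
Proof.
move=> /(_ x) /(cvg_lim (@norm_hausdorff _ _)) <-.
apply: lim_near_cst; first exact: norm_hausdorff.
near=> n; have mn : (m <= n)%N by near: n; exact: nbhs_infty_ge.
rewrite /series/= (@big_cat_nat _ _ _ m 0%N n)//= [X in _ + X]big_nat.
rewrite [X in _ + X]big1 ?addr0 => [|i /andP[mi _]]; last first.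
  by rewrite ltnNge mi mul0r.
by rewrite big_nat [RHS]big_nat; apply: eq_bigr => i /andP[_ ->].
Unshelve. all: by end_near. Qed.

(** The gap between [c] and the threshold makes the set norm-open. The thresholds tend to zero,
    which later leaves finitely many [n], and the shift by two keeps them at most 1/2. *)
Definition small_tail_ball : set (dual ell1) :=
  [set f : dual ell1 | `|f| < 1 /\ exists n (c : K), c < n.+2%:R^-1 /\
    forall j, (n <= j)%N -> `|f (ell1_unit j)| <= c].

Lemma open_small_tail_ball : open small_tail_ball.
Proof.
rewrite openE => /= f [f1 [n [c [cn fc]]]].
have f1' : 0 < 1 - `|f| by rewrite subr_gt0.
have cn' : 0 < n.+2%:R^-1 - c by rewrite subr_gt0.
have cn2 : 0 < (n.+2%:R^-1 - c) / 2 by rewrite divr_gt0.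
have near_f (d : K) : 0 < d -> \forall g \near f, `|f - g| < d.
  by move=> d0; apply/nbhs_ballP; exists d => //= h; rewrite -ball_normE.
rewrite /interior; near=> g.
have fg1 : `|f - g| < 1 - `|f| by near: g; exact: near_f.
have fg2 : `|f - g| < (n.+2%:R^-1 - c) / 2.
  by near: g; exact: near_f.
split.
  rewrite -[g](subrK f) (le_lt_trans (ler_normD _ _))// distrC.
  by rewrite -ltrBrDr.
(* The new tail bound is the midpoint of [c] and the threshold. *)
exists n, ((n.+2%:R^-1 - c) / 2 + c); split.
  by rewrite -ltrBrDr ltr_pdivrMr// ltr_pMr// ltr1n.
move=> j nj; rewrite -[g](subrK f) (le_trans (ler_normD _ _))// lerD ?fc//.
by apply: le_trans (dual_ell1_unit_le _ _) _; rewrite distrC ltW.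
Unshelve. all: by end_near. Qed.

Lemma balanced_small_tail_ball : balanced small_tail_ball.
Proof.
move=> t f t1 [f1 [n [c [cn fc]]]]; split.
  by rewrite normrZ (le_lt_trans _ f1)// ler_piMl.
exists n, c; split=> // j nj; apply: le_trans (fc _ nj).
by rewrite (normrZ t (f _ : K^o)) ler_piMl.
Qed.

Lemma small_tail_ball_proper : small_tail_ball `<` @dual_unit_ball R k ell1.
Proof.
split=> [f []//|UB].
have a2 (n : nat) : `|2^-1 : K^o| <= 2^-1 :> K by rewrite ger0_norm ?invr_ge0.
have [f fP] := bounded_pairing_exists a2.
have f2 : `|f| <= 2^-1 by exact: bounded_pairing_dual_norm_le a2 fP.
have [|_ [n [c [cn /(_ n (leqnn n))]]]] := UB f.
  by apply: le_lt_trans f2 _; rewrite invf_lt1 ?ltr1n.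
rewrite (ell1_pairing_unit n fP) ger0_norm ?invr_ge0// => /le_lt_trans/(_ cn).
by rewrite ltf_pV2 ?posrE// ltr_nat.
Qed.

(** Move [z] radially outward by [s]; at the origin, where there is no radial direction, [w = s]
    works. *)
Lemma scalar_enlarge (z s : K) : 0 <= s ->
  exists w, `|w| <= s /\ `|z + w| = `|z| + s.
Proof.
move=> s0; have [->|z0] := eqVneq z 0.
  by exists s; rewrite normr0 !add0r ger0_norm.
have nz0 : 0 < `|z| by rewrite normr_gt0.
exists (z * (s / `|z|)); split.
  by rewrite normrM normf_div normr_id mulrC divfK ?gt_eqF// ger0_norm.
rewrite -[X in X + _]mulr1 -mulrDr normrM [X in _ * X]ger0_norm.
  by rewrite mulrDr mulr1 mulrC divfK// gt_eqF.
by rewrite addr_ge0// divr_ge0.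
Qed.

(** Every bounded sequence defines a functional, so a single [h] of norm at most [e] can push all
    coordinates outward at once. The bounds for [g + h] then hold for [g] with margin [e]. *)
Lemma small_tail_ball_perturbation (e : K) (g : dual ell1) : 0 < e ->
  (forall h, `|h| <= e -> small_tail_ball (g + h)) ->
  (forall j, `|g (ell1_unit j)| <= 1 - e) /\
  exists2 n, e < n.+2%:R^-1 &
    forall j, (n <= j)%N -> `|g (ell1_unit j)| <= n.+2%:R^-1 - e.
Proof.
move=> e0 gU.
have [b /all_and2[be gb]] :=
  choice (fun j => @scalar_enlarge (g (ell1_unit j)) e (ltW e0)).
have [h hP] := bounded_pairing_exists be.
have ghE j : `|(g + h) (ell1_unit j)| = `|g (ell1_unit j)| + e.
  by rewrite -gb -(ell1_pairing_unit j hP).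
have [gh1 [n [c [cn gc]]]] := gU h (bounded_pairing_dual_norm_le be hP).
split=> [j|].
  by rewrite lerBrDr -ghE (le_trans (dual_ell1_unit_le _ _))// ltW.
exists n => [|j nj]; last by rewrite lerBrDr -ghE (le_trans (gc _ nj))// ltW.
(* The enlarged coordinate at [n] has modulus at least [e] and at most [c]. *)
apply: le_lt_trans cn; apply: le_trans (gc n (leqnn n)).
by rewrite ghE lerDr.
Qed.

Lemma envelope_small_tail_ball : envelope small_tail_ball = small_tail_ball.
Proof.
apply/seteqP; split; last exact/sub_envelope/open_small_tail_ball.
move=> f [B [BU _ [e e0 Be]] Bf].
(* Points outside the set are at distance at least [e] from [B], so perturbations of norm at most
   [e / 2] stay inside. *)
have s0 : 0 < e / 2 by rewrite divr_gt0.
set s := e / 2 in s0.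
have BP g : B g -> (forall j, `|g (ell1_unit j)| <= 1 - s) /\
  exists2 n, s < n.+2%:R^-1 &
    forall j, (n <= j)%N -> `|g (ell1_unit j)| <= n.+2%:R^-1 - s.
  move=> Bg; apply: small_tail_ball_perturbation => // h hs.
  apply: contrapT => /(Be _ _ Bg); rewrite opprD addrA subrr sub0r normrN.
  move=> /le_trans/(_ hs) /le_gtF; rewrite /s.
  by rewrite ltr_pdivrMr// ltr_pMr// ltr1n.
have [N NP] := scalar_archimedean s0.
(* The open unit ball is not preserved by weak* limits; the bound [1 - s] on coordinates is, and it
   still forces norm less than 1. *)
pose F n : set (dual ell1) := [set g |
  (forall j, `|g (ell1_unit j)| <= 1 - s) /\
  forall j, (n <= j)%N -> `|g (ell1_unit j)| <= n.+2%:R^-1 - s].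
have closedF n : closed (F n : set (weak_star ell1)).
  move=> g Fg; split=> [j|j nj].
    by apply: weak_star_closure_norm_le Fg => g' [].
  by apply: weak_star_closure_norm_le Fg => g' [_]; apply.
(* From [N] on the thresholds are below [s], so only indices below [N] occur, and a finite union of
   closed sets is closed. *)
have BF : B `<=` \bigcup_(n in `I_N) F n.
  move=> g /BP[g1 [n sn gn]]; exists n => //=.
  by rewrite ltnNge; apply/negP => /NP/(lt_trans sn); rewrite ltxx.
have [n _ [f1 fn]] : (\bigcup_(n in `I_N) F n) f.
  have closedU : closed (\bigcup_(n in `I_N) F n : set (weak_star ell1)).
    by apply: closed_bigcup => // n _; exact: closedF.
  by apply: closedU; exact: closureS Bf.
split; first by rewrite (le_lt_trans (dual_ell1_norm_le f1))// gtrBl.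
by exists n, (n.+2%:R^-1 - s); rewrite gtrBl.
Qed.

(** Truncating the coordinates of [f] at [m] does not raise the norm and gives the tail bound
    [c = 0]; the values at [x] are the partial sums of the series for [f x]. *)
Lemma small_tail_ball_dense :
  @dual_unit_ball R k ell1 `<=` weak_star_closure small_tail_ball.
Proof.
move=> f f1.
pose a m (i : nat) : K^o := if (i < m)%N then f (ell1_unit i) else 0.
have af m i : `|a m i| <= `|f|.
  by rewrite /a; case: ifP => _; rewrite ?normr0// dual_ell1_unit_le.
have [u uP] := choice (fun m => bounded_pairing_exists (af m)).
apply: (@weak_star_closure_cvg _ _ _ _ u) => [m|x].
  split.
    exact: le_lt_trans (bounded_pairing_dual_norm_le (af m) (uP m)) f1.
  exists m, 0; split=> [|j mj]; first by rewrite invr_gt0.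
  by rewrite (ell1_pairing_unit j (uP m)) /a ltnNge mj normr0.
rewrite (_ : u ^~ x = [series f (ell1_unit n) * x n]_n).
  exact: ell1_pairing_units.
by apply/funext => m; exact: finite_pairingE (uP m).
Qed.

Lemma small_tail_ball_dense_envelope_fixed :
  dense_envelope_fixed small_tail_ball.
Proof.
split; [exact: open_small_tail_ball|exact: balanced_small_tail_ball|
  exact: small_tail_ball_proper|exact: envelope_small_tail_ball|
  exact: small_tail_ball_dense].
Qed.

End EllOne.

Theorem mainTheorem1 (R : realType) (k : scalar_kind) :
  (exists X : completeNormedModType (scalar_field R k),
     separable_space X /\
     exists U : set (dual X), dense_envelope_fixed U) /\
  [/\ separable_space (ell1 R k),
      dual_ell1_is_ellinfty R k &
      exists U : set (dual (ell1 R k)), dense_envelope_fixed U].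
Proof.
split.
  exists (ell1 R k); split; first exact: ell1_separable.
  by exists (@small_tail_ball R k); exact: small_tail_ball_dense_envelope_fixed.
split; [exact: ell1_separable|exact: dual_ell1_ellinfty|].
by exists (@small_tail_ball R k); exact: small_tail_ball_dense_envelope_fixed.
Qed.
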